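(* Let $\alpha_1,\alpha_2>0$ and $\sigma_1,\sigma_2>0$. Let $W,Y_1,Y_2$ be independent random variables with $W\sim \mathrm{Exp}(1)$ and $Y_i^{-1}\sim\Gamma(\alpha_i,1)$ for $i=1,2$, and define $X_1=\sigma_1 W Y_1$ and $X_2=\sigma_2 W Y_2$. Then the copula of $(X_1,X_2)$ is the function $C:[0,1]^2\to[0,1]$ given by $$ C(u_1,u_2)=\begin{cases} u_1+u_2-1+\displaystyle\int_0^\infty F_{G_1}\!\left(\frac{w}{(1-u_1)^{-1/\alpha_1}-1}\right)F_{G_2}\!\left(\frac{w}{(1-u_2)^{-1/\alpha_2}-1}\right)e^{-w}\,dw & \text{if }(u_1,u_2)\in(0,1)^2,\\ u_1 & \text{if } u_1\in[0,1],\ u_2=1,\\ u_2 & \text{if } u_1=1,\ u_2\in[0,1),\\ 0 & \text{otherwise,} \end{cases} $$ where $F_{G_i}$ is the cumulative distribution function of $G_i\sim\Gamma(\alpha_i,1)$, $i=1,2$.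
   Context: $\mathrm{Exp}(1)$ is the exponential distribution with rate $1$; $\Gamma(\alpha,1)$ is the gamma distribution with shape $\alpha$ and rate $1$, i.e. with density $x^{\alpha-1}e^{-x}/\Gamma(\alpha)$ on $(0,\infty)$. A (two-dimensional) copula is a function $C:[0,1]^2\to\mathbb{R}$ such that: (grounded) $C(0,v)=0=C(u,0)$ for all $u,v\in[0,1]$; (2-increasing) $C(y_1,y_2)-C(y_1,x_2)-C(x_1,y_2)+C(x_1,x_2)\ge 0$ whenever $0\le x_1\le y_1\le 1$ and $0\le x_2\le y_2\le 1$; and $C(u,1)=u$, $C(1,v)=v$ for all $u,v\in[0,1]$. If $X_1,X_2$ have joint distribution function $H$ and continuous marginal distribution functions $F_{X_1},F_{X_2}$, the copula of $(X_1,X_2)$ is the unique copula $C$ satisfying $H(x_1,x_2)=C(F_{X_1}(x_1),F_{X_2}(x_2))$ for all $x_1,x_2\in[-\infty,\infty]$ (existence and uniqueness by Sklar's theorem). *)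

(* Defs.v *)
From HB Require Import structures.
From mathcomp Require Import all_boot all_order all_algebra.
From mathcomp Require Import all_classical all_reals all_analysis.

Set Implicit Arguments.
Unset Strict Implicit.
Unset Printing Implicit Defensive.

Import Order.TTheory GRing.Theory Num.Theory.
Import numFieldNormedType.Exports.

Local Open Scope classical_set_scope.
Local Open Scope ring_scope.

(* Two set functions on R are the same law when they agree on Borel sets;
   nothing is claimed about non-measurable sets. *)
Definition same_law {R : realType} (mu nu : set R -> \bar R) : Prop :=
  forall A : set R, measurable A -> mu A = nu A.

Section gamma_distribution.
Context {R : realType}.

Definition gamma_fun (a : R) : R :=
  \int[lebesgue_measure]_(x in `]0, +oo[) (x `^ (a - 1) * expR (- x)).

Definition gamma_pdf (a : R) : R -> R :=
  (fun x => x `^ (a - 1) * expR (- x) / gamma_fun a) \_ `]0, +oo[.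

Definition gamma_prob (a : R) (A : set R) : \bar R :=
  (\int[lebesgue_measure]_(x in A) (gamma_pdf a x)%:E)%E.

Definition gamma_cdf (a x : R) : R := fine (gamma_prob a `]-oo, x]).

End gamma_distribution.

(* Mutual independence; the product rule for pairs is the case where one of
   the sets is setT. *)
Definition independent3 d (T : measurableType d) (R : realType)
    (P : probability T R) (X Y Z : T -> R) : Prop :=
  forall A B C : set R, measurable A -> measurable B -> measurable C ->
  P (X @^-1` A `&` Y @^-1` B `&` Z @^-1` C) =
  (P (X @^-1` A) * P (Y @^-1` B) * P (Z @^-1` C))%E.

(* Functions on [0, 1]^2 are represented by functions on R^2 whose values
   outside the unit square are irrelevant. *)
Definition is_copula {R : realType} (C : R -> R -> R) : Prop :=
  [/\ forall u v : R, 0 <= u <= 1 -> 0 <= v <= 1 -> C 0 v = 0 /\ C u 0 = 0,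
      forall x1 y1 x2 y2 : R,
        0 <= x1 -> x1 <= y1 -> y1 <= 1 -> 0 <= x2 -> x2 <= y2 -> y2 <= 1 ->
        0 <= C y1 y2 - C y1 x2 - C x1 y2 + C x1 x2 &
      forall u v : R, 0 <= u <= 1 -> 0 <= v <= 1 -> C u 1 = u /\ C 1 v = v].

Section copula_of.
Context d (T : measurableType d) (R : realType) (P : probability T R).

(* Distribution functions with arguments in [-oo, +oo]. *)
Definition ext_cdf (X : {RV P >-> R}) (x : \bar R) : R :=
  fine (P [set t | ((X t)%:E <= x)%E]).

Definition ext_joint_cdf (X1 X2 : {RV P >-> R}) (x1 x2 : \bar R) : R :=
  fine (P [set t | ((X1 t)%:E <= x1)%E /\ ((X2 t)%:E <= x2)%E]).

Lemma ext_cdf_fin (X : {RV P >-> R}) (r : R) : ext_cdf X r%:E = fine (cdf X r).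
Proof.
rewrite /ext_cdf /cdf /distribution /pushforward; congr (fine (P _)).
Qed.

Definition sklar_identity (X1 X2 : {RV P >-> R}) (C : R -> R -> R) : Prop :=
  forall x1 x2 : \bar R, ext_joint_cdf X1 X2 x1 x2 = C (ext_cdf X1 x1) (ext_cdf X2 x2).

(* The copula is only defined for continuous margins, so their continuity is
   part of the assertion, as is uniqueness on the unit square. *)
Definition is_copula_of (X1 X2 : {RV P >-> R}) (C : R -> R -> R) : Prop :=
  [/\ continuous (cdf X1), continuous (cdf X2),
      is_copula C, sklar_identity X1 X2 C &
      forall C' : R -> R -> R, is_copula C' -> sklar_identity X1 X2 C' ->
        forall u v : R, 0 <= u <= 1 -> 0 <= v <= 1 -> C' u v = C u v].

End copula_of.

Definition exp_gamma_copula {R : realType} (a1 a2 u1 u2 : R) : R :=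
  if (0 < u1 < 1) && (0 < u2 < 1) then
    u1 + u2 - 1 +
    \int[lebesgue_measure]_(w in `]0, +oo[)
      (gamma_cdf a1 (w / ((1 - u1) `^ (- 1 / a1) - 1)) *
       gamma_cdf a2 (w / ((1 - u2) `^ (- 1 / a2) - 1)) * expR (- w))
  else if (0 <= u1 <= 1) && (u2 == 1) then u1
  else if (u1 == 1) && (0 <= u2 < 1) then u2
  else 0.

(* Main.v *)
Require Import Defs.
From HB Require Import structures.
From mathcomp Require Import all_boot all_order all_algebra.
From mathcomp Require Import all_classical all_reals all_analysis.
From mathcomp Require Import measurable_realfun.
From mathcomp Require Import ring lra.
Import Order.TTheory GRing.Theory Num.Theory.
Import numFieldNormedType.Exports.
Local Open Scope classical_set_scope.
Local Open Scope ring_scope.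

Set Implicit Arguments.
Unset Strict Implicit.
Unset Printing Implicit Defensive.

(* Write G_i = 1 / Y_i. Almost surely X_i > x iff (x / sigma_i) G_i < W, so
   P(X_i > x) is the Laplace transform of G_i at x / sigma_i, which is
   (1 + x / sigma_i)^(- alpha_i). Conditioning on W, the G_i being independent,
   P(X_1 > x_1, X_2 > x_2) is the integral of
   F_{G_1}(w sigma_1 / x_1) F_{G_2}(w sigma_2 / x_2) e^(-w), and
   w sigma_i / x_i = w / ((1 - u_i)^(-1 / alpha_i) - 1) when u_i = F_{X_i}(x_i).
   Inclusion-exclusion gives the Sklar identity. Every level in [0, 1] is attained
   by the margins over [-oo, +oo], so that identity alone yields the copula
   axioms, the bounds and uniqueness. *)

(** * Probabilities of rectangles and of almost sure intersections *)

Section probability_rectangle.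
Context d (T : measurableType d) (R : realType) (P : probability T R).

Lemma fine_probability_setI_diff (S A B : set T) :
  measurable S -> measurable A -> measurable B -> A `<=` B ->
  fine (P (S `&` B)) - fine (P (S `&` A)) = fine (P (S `&` (B `\` A))).
Proof.
move=> mS mA mB AB.
have mBA : measurable (B `\` A) by exact: measurableD.
have -> : S `&` B = (S `&` A) `|` (S `&` (B `\` A)).
  by rewrite -setIUr setDUK.
rewrite measureU; [|exact: measurableI|exact: measurableI|]; last first.
  by apply/seteqP; split=> // t [[_ At] [_ [_]]].
by rewrite fineD ?fin_num_measure//; [lra|exact: measurableI|exact: measurableI].
Qed.

(** The first two terms give the probability of [A' & (B' \ B)], the last two subtract that of
    [A & (B' \ B)], a smaller event. Applied to sublevel events of two variables, this is the
    2-increasing axiom. *)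
Lemma probability_rectangle_ge0 (A A' B B' : set T) :
  measurable A -> measurable A' -> measurable B -> measurable B' ->
  A `<=` A' -> B `<=` B' ->
  0 <= fine (P (A' `&` B')) - fine (P (A' `&` B)) -
       fine (P (A `&` B')) + fine (P (A `&` B)).
Proof.
move=> mA mA' mB mB' AA' BB'.
have E1 := fine_probability_setI_diff mA' mB mB' BB'.
have E2 := fine_probability_setI_diff mA mB mB' BB'.
have mD : measurable (B' `\` B) by exact: measurableD.
have : fine (P (A `&` (B' `\` B))) <= fine (P (A' `&` (B' `\` B))).
  rewrite fine_le ?fin_num_measure//; try exact: measurableI.
  by apply: le_measure; rewrite ?inE; [exact: measurableI|exact: measurableI|exact: setSI].
lra.
Qed.

(** [B] splits along [A] and its complement, and the second piece is null. *)
Lemma probability1_setI (A B : set T) : measurable A -> measurable B ->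
  P A = 1%E -> P (A `&` B) = P B.
Proof.
move=> mA mB PA.
have PAC : P (~` A) = 0%E by rewrite probability_setC// PA subee.
rewrite -[in RHS](setIT B) -(setvU A) setIUr measureU.
- rewrite [X in _ = (X + _)%E](_ : _ = 0%E) ?add0e 1?setIC//.
  apply/eqP; rewrite -measure_le0 -PAC le_measure ?inE//.
    by apply: measurableI => //; exact: measurableC.
  exact: measurableC.
- by apply: measurableI => //; exact: measurableC.
- exact: measurableI.
- by rewrite setIACA setICl setI0.
Qed.

(** This makes almost sure rewriting possible: with [A] the event that the [Y] variables are
    positive, inequalities may be divided by them. *)
Lemma eq_probability_setI1 (A B C : set T) :
  measurable A -> measurable B -> measurable C ->
  P A = 1%E -> A `&` B = A `&` C -> P B = P C.
Proof.
move=> mA mB mC PA ABC.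
by rewrite -(probability1_setI mA mB PA) ABC probability1_setI.
Qed.

End probability_rectangle.

(** * Distribution functions on the extended line and the Sklar identity *)

Section sklar.
Context d (T : measurableType d) (R : realType) (P : probability T R).
Implicit Types (X : {RV P >-> R}) (x : \bar R).

Lemma measurable_le_ereal X x : measurable [set t | ((X t)%:E <= x)%E].
Proof.
case: x => [r| |].
- have -> : [set t | ((X t)%:E <= r%:E)%E] = X @^-1` `]-oo, r].
    by apply/seteqP; split=> t /=; rewrite in_itv/= lee_fin.
  exact: measurable_funPTI.
- have -> : [set t | ((X t)%:E <= +oo)%E] = setT.
    by apply/seteqP; split=> t //= _; rewrite leey.
  exact: measurableT.
- have -> : [set t | ((X t)%:E <= -oo)%E] = set0.
    by apply/seteqP; split=> t.
  exact: measurable0.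
Qed.
Local Hint Resolve measurable_le_ereal : core.

Lemma ext_cdf_le X : {homo ext_cdf X : x y / (x <= y)%E >-> x <= y}.
Proof.
move=> x y xy; rewrite /ext_cdf fine_le ?fin_num_measure//.
by apply: le_measure; rewrite ?inE// => t /= /le_trans; apply.
Qed.

Lemma ext_cdf_range X x : 0 <= ext_cdf X x <= 1.
Proof.
rewrite /ext_cdf fine_ge0//= -[leRHS]/(fine 1%:E).
by rewrite fine_le ?fin_num_measure// probability_le1.
Qed.

Lemma ext_cdfNy X : ext_cdf X -oo%E = 0.
Proof.
rewrite /ext_cdf (_ : [set _ | _] = set0) ?measure0//.
by apply/seteqP; split=> t.
Qed.

Lemma ext_cdfy X : ext_cdf X +oo%E = 1.
Proof.
rewrite /ext_cdf (_ : [set _ | _] = setT) ?probability_setT//.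
by apply/seteqP; split=> t //= _; rewrite leey.
Qed.

Lemma ext_joint_cdfC X1 X2 x1 x2 :
  ext_joint_cdf X1 X2 x1 x2 = ext_joint_cdf X2 X1 x2 x1.
Proof.
by rewrite /ext_joint_cdf; congr (fine (P _)); apply/seteqP; split=> t [].
Qed.

Lemma measurable_le_ereal2 X1 X2 x1 x2 :
  measurable [set t | ((X1 t)%:E <= x1)%E /\ ((X2 t)%:E <= x2)%E].
Proof. exact: (measurableI _ _ (measurable_le_ereal X1 x1) (measurable_le_ereal X2 x2)). Qed.
Local Hint Resolve measurable_le_ereal2 : core.

Lemma ext_joint_cdf_lel X1 X2 x1 x2 :
  ext_joint_cdf X1 X2 x1 x2 <= ext_cdf X1 x1.
Proof.
rewrite /ext_joint_cdf /ext_cdf fine_le ?fin_num_measure//.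
by apply: le_measure; rewrite ?inE// => t [].
Qed.

Lemma ext_joint_cdf_ge0 X1 X2 x1 x2 : 0 <= ext_joint_cdf X1 X2 x1 x2.
Proof. by rewrite /ext_joint_cdf fine_ge0. Qed.

Lemma ext_joint_cdf_yr X1 X2 x1 :
  ext_joint_cdf X1 X2 x1 +oo%E = ext_cdf X1 x1.
Proof.
rewrite /ext_joint_cdf /ext_cdf; congr (fine (P _)).
by apply/seteqP; split=> t /= => [[]//|]; split=> //; rewrite leey.
Qed.

Lemma ext_joint_cdf_eq0 X1 X2 x1 x2 :
  ext_cdf X1 x1 = 0 -> ext_joint_cdf X1 X2 x1 x2 = 0.
Proof.
move=> F0; apply/eqP; rewrite eq_le ext_joint_cdf_ge0 andbT -F0.
exact: ext_joint_cdf_lel.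
Qed.

Lemma ext_joint_cdf_eq1 X1 X2 x1 x2 :
  ext_cdf X1 x1 = 1 -> ext_joint_cdf X1 X2 x1 x2 = ext_cdf X2 x2.
Proof.
move=> F1; rewrite /ext_joint_cdf /ext_cdf; congr fine.
apply: (probability1_setI (measurable_le_ereal X1 x1) (measurable_le_ereal X2 x2)).
by rewrite -[LHS]fineK ?fin_num_measure// -/(ext_cdf X1 x1) F1.
Qed.

(* If every level in [0, 1] is attained by both margins, the Sklar identity
   transports all the properties of the joint distribution function to C. *)
Section attained_levels.
Context (X1 X2 : {RV P >-> R}) (C : R -> R -> R).
Hypothesis onto1 : forall u, 0 <= u <= 1 -> exists x, ext_cdf X1 x = u.
Hypothesis onto2 : forall u, 0 <= u <= 1 -> exists x, ext_cdf X2 x = u.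
Hypothesis sklar : sklar_identity X1 X2 C.

Lemma sklar_copula_range u v : 0 <= u <= 1 -> 0 <= v <= 1 -> 0 <= C u v <= 1.
Proof.
move=> /onto1[x <-] /onto2[y <-]; rewrite -sklar ext_joint_cdf_ge0/=.
by rewrite (le_trans (ext_joint_cdf_lel _ _ _ _))//; have /andP[] := ext_cdf_range X1 x.
Qed.

Lemma sklar_copula_unique C' : sklar_identity X1 X2 C' ->
  forall u v, 0 <= u <= 1 -> 0 <= v <= 1 -> C' u v = C u v.
Proof. by move=> sk' u v /onto1[x <-] /onto2[y <-]; rewrite -sklar -sk'. Qed.

(** Arbitrary preimages of [u <= v] may come in the wrong order, but then monotonicity forces
    [u = v], and one point serves for both levels. *)
Let attain_ordered X (onto : forall u, 0 <= u <= 1 -> exists x, ext_cdf X x = u)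
    u v : 0 <= u -> u <= v -> v <= 1 ->
  exists x y, [/\ ext_cdf X x = u, ext_cdf X y = v & (x <= y)%E].
Proof.
move=> u0 uv v1.
have /onto[x Fx] : 0 <= u <= 1 by rewrite u0 (le_trans uv).
have /onto[y Fy] : 0 <= v <= 1 by rewrite v1 (le_trans u0).
have [xy|/ltW/(ext_cdf_le X) yx] := leP x y; first by exists x, y.
have uv' : u = v by apply/eqP; rewrite eq_le uv/= -Fx -Fy.
by exists x, x; split=> //; rewrite Fx.
Qed.

Lemma sklar_is_copula : is_copula C.
Proof.
split.
- move=> u v /onto1[x <-] /onto2[y <-]; split.
    by rewrite -(ext_cdfNy X1) -sklar ext_joint_cdf_eq0// ext_cdfNy.
  by rewrite -(ext_cdfNy X2) -sklar ext_joint_cdfC ext_joint_cdf_eq0// ext_cdfNy.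
- move=> u1 v1 u2 v2 u10 uv1 v11 u20 uv2 v21.
  have [x1 [y1 [<- <- xy1]]] := attain_ordered onto1 u10 uv1 v11.
  have [x2 [y2 [<- <- xy2]]] := attain_ordered onto2 u20 uv2 v21.
  rewrite -!sklar; apply: probability_rectangle_ge0; try exact: measurable_le_ereal.
    by move=> t /= /le_trans; apply.
  by move=> t /= /le_trans; apply.
- move=> u v /onto1[x <-] /onto2[y <-]; split.
    by rewrite -(ext_cdfy X2) -sklar ext_joint_cdf_yr.
  by rewrite -(ext_cdfy X1) -sklar ext_joint_cdfC ext_joint_cdf_yr.
Qed.

End attained_levels.

End sklar.

(** * Independence as a product law *)

Section independence.
Context d d1 d2 (T : measurableType d) (T1 : measurableType d1)
  (T2 : measurableType d2) (R : realType) (P : probability T R).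
Variables (U : {mfun T >-> T1}) (V : {mfun T >-> T2}).

(** The law of [(U, V)] agrees with the product of the two laws on measurable rectangles, hence
    everywhere; the product measure of [D] is by construction the integral of the measures of its
    sections. *)
Lemma independent_fubini :
  (forall A B, measurable A -> measurable B ->
    P (U @^-1` A `&` V @^-1` B) = (P (U @^-1` A) * P (V @^-1` B))%E) ->
  forall D : set (T1 * T2), measurable D ->
  (P [set t | D (U t, V t)] =
   \int[distribution P U]_x P (V @^-1` [set y | D (x, y)]))%E.
Proof.
move=> UV D mD.
have mUV : measurable_fun setT (fun t => (U t, V t)).
  exact: measurable_fun_pair.
pose W : {mfun T >-> (T1 * T2)%type} :=
  HB.pack (fun t => (U t, V t)) (isMeasurableFun.Build _ _ _ _ _ mUV).
have -> : P [set t | D (U t, V t)] = distribution P W D by [].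
rewrite -(@product_measure_unique _ _ _ _ _ (distribution P U) (distribution P V)).
- rewrite /product_measure1; apply: eq_integral => x _ /=.
  rewrite /xsection /distribution /pushforward; congr (P _).
  by apply/seteqP; split=> t; rewrite /= inE.
- by move=> A B mA mB; rewrite [LHS]UV.
- exact: mD.
Qed.

End independence.

Section independence_pair.
Context d (T : measurableType d) (R : realType) (P : probability T R).
Variables (X Y Z : {mfun T >-> R}).

(** For fixed [A], both sides are finite measures in [B]. They agree on rectangles, which are stable
    under intersection and generate the product sigma-algebra, so they coincide. *)
Lemma independent3_pair : independent3 P X Y Z ->
  forall (A : set R) (B : set (R * R)), measurable A -> measurable B ->
  (P (X @^-1` A `&` (fun t => (Y t, Z t)) @^-1` B) =
   P (X @^-1` A) * P ((fun t => (Y t, Z t)) @^-1` B))%E.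
Proof.
move=> ind A B mA mB.
have mYZ : measurable_fun setT (fun t => (Y t, Z t)).
  exact: measurable_fun_pair.
pose V : {mfun T >-> (R * R)%type} :=
  HB.pack (fun t => (Y t, Z t)) (isMeasurableFun.Build _ _ _ _ _ mYZ).
have mXA : measurable (X @^-1` A) by exact: measurable_funPTI.
have PXA : (fine (P (X @^-1` A)))%:E = P (X @^-1` A) by rewrite fineK ?fin_num_measure.
have PXA0 : 0 <= fine (P (X @^-1` A)) by rewrite fine_ge0.
pose m1 := pushforward (mrestr P mXA) V.
pose m2 := mscale (NngNum PXA0) (distribution P V).
have : m1 B = m2 B.
  rewrite /m1 /m2; apply: (measure_unique
    [set C `*` D | C in measurable & D in measurable] (fun=> setT)) => //.
  - exact: measurable_prod_measurableType.
  - move=> _ _ [C1 mC1 [D1 mD1 <-]] [C2 mC2 [D2 mD2 <-]].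
    exists (C1 `&` C2); first exact: measurableI.
    by exists (D1 `&` D2); [exact: measurableI|rewrite setXI].
  - by move=> _; exists setT => //; exists setT => //; rewrite setXTT.
  - by rewrite bigcup_const//; exists 0%N.
  - move=> _ [C mC [D mD <-]].
    transitivity (P (X @^-1` A) * P (Y @^-1` C `&` Z @^-1` D))%E; last first.
      by rewrite -[in LHS]PXA.
    (* The triple rule with [setT] in first place factors the event in [(Y, Z)]; the rule with [A]
       then matches the two products. *)
    have := ind setT C D measurableT mC mD.
    rewrite preimage_setT setTI probability_setT mul1e => ->.
    have := ind A C D mA mC mD; rewrite -muleA => <-.
    by rewrite -setIA setIC.
  - move=> _; rewrite /= /pushforward /mrestr /= preimage_setT setTI.
    by rewrite ltey_eq fin_num_measure.
by rewrite /m1 /m2 /mscale /= /pushforward /mrestr/= PXA setIC.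
Qed.

Lemma independent3_sym : independent3 P X Y Z ->
  (forall A B, measurable A -> measurable B ->
    P (Y @^-1` A `&` X @^-1` B) = (P (Y @^-1` A) * P (X @^-1` B))%E) /\
  (forall A B, measurable A -> measurable B ->
    P (Z @^-1` A `&` X @^-1` B) = (P (Z @^-1` A) * P (X @^-1` B))%E).
Proof.
move=> ind; split=> A B mA mB.
  have := ind B A setT mB mA measurableT.
  by rewrite preimage_setT setIT probability_setT mule1 setIC muleC.
have := ind B setT A mB measurableT mA.
by rewrite preimage_setT setIT probability_setT mule1 setIC muleC.
Qed.

End independence_pair.

(** * Integration against a density, and scaling of Lebesgue measure *)

Section density.
Context d (X : measurableType d) (R : realType).
Variables (nu : {finite_measure set X -> \bar R}).
Variables (mu : {sigma_finite_measure set X -> \bar R}).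

(** A null set of [mu] has [g]-integral zero, so [nu] is absolutely continuous. Its Radon-Nikodym
    derivative has the same integral as [g] over every measurable set, hence equals [g] almost
    everywhere, and the change of variables for the derivative transfers to [g]. *)
Lemma integral_density (g f : X -> \bar R) :
  measurable_fun setT g -> (forall x, 0 <= g x)%E ->
  (forall A, measurable A -> nu A = \int[mu]_(x in A) g x)%E ->
  measurable_fun setT f -> (forall x, 0 <= f x)%E ->
  (\int[nu]_x f x = \int[mu]_x (f x * g x))%E.
Proof.
move=> mg g0 nuE mf f0.
have numu : nu `<< mu.
  apply/null_content_dominatesP => A mA A0; rewrite nuE// null_set_integral//.
  exact: measurable_funTS.
rewrite -(Radon_Nikodym_SigmaFinite.change_of_variables numu)//.
have RN := Radon_Nikodym_SigmaFinite.f_integrable numu.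
apply: ae_eq_integral => //.
- by apply: emeasurable_funM => //; exact: measurable_int RN.
- exact: emeasurable_funM.
apply: ae_eqe_mul2l.
apply: integral_ae_eq => //.
by move=> E _ mE; rewrite -Radon_Nikodym_SigmaFinite.f_integral// nuE.
Qed.

End density.

Section scaling.
Context (R : realType).
Local Notation mu := (@lebesgue_measure R).

(** The right-hand side is a measure in [A] giving each half-open interval its length, which
    characterizes Lebesgue measure. *)
Lemma lebesgue_measure_scale (c : R) (A : set R) : 0 < c -> measurable A ->
  (mu A = c%:E * mu ( *%R c @^-1` A))%E.
Proof.
move=> c0 mA.
have mc : measurable_fun setT ( *%R c : measurableTypeR R -> measurableTypeR R).
  exact: measurable_funM.
pose h : {mfun measurableTypeR R >-> measurableTypeR R} :=
  HB.pack ( *%R c) (isMeasurableFun.Build _ _ _ _ _ mc).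
pose nu := mscale (NngNum (ltW c0)) (pushforward mu h : measure (measurableTypeR R) R).
suff -> : mu A = nu mc A by [].
apply: lebesgue_measure_unique => //= _ [[a b]] _ <-.
rewrite /nu /mscale/= /pushforward.
have -> : ( *%R c) @^-1` `]a, b] = `]a / c, b / c]%classic.
  by apply/seteqP; split=> x /=; rewrite !in_itv/= ltr_pdivrMr// ler_pdivlMr// (mulrC x).
rewrite !lebesgue_measure_itv/= !lte_fin ltr_pM2r ?invr_gt0//.
by case: ifPn => _; rewrite ?mule0// -EFinB -EFinM; congr EFin; field; rewrite gt_eqF.
Qed.

Lemma integral_lebesgue_scale (c : R) (f : R -> \bar R) : 0 < c ->
  measurable_fun setT f -> (forall x, 0 <= f x)%E ->
  (\int[mu]_x f (c * x)%R = c^-1%:E * \int[mu]_x f x)%E.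
Proof.
move=> c0 mf f0.
have mc : measurable_fun setT ( *%R c : measurableTypeR R -> measurableTypeR R).
  exact: measurable_funM.
have -> : (\int[mu]_x f x = c%:E * \int[mu]_x f (c * x)%R)%E.
  rewrite -(@ge0_integral_pushforward _ _ (measurableTypeR R)
    (measurableTypeR R) _ ( *%R c) mc mu setT)//.
  rewrite -(@ge0_integral_mscale _ _ _ _ _ _ (NngNum (ltW c0)))//.
  by apply: eq_measure_integral => //= A mA _; rewrite /mscale/= -lebesgue_measure_scale.
by rewrite muleA -EFinM mulVf ?gt_eqF// mul1e.
Qed.

End scaling.

Section random_variable_density.
Context d (T : measurableType d) (R : realType) (P : probability T R).

(* [R] and [measurableTypeR R], on which the Lebesgue measure lives, have the
   same measurable sets but distinct displays: W is viewed in both. *)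
Lemma integral_distribution_density (W : {RV P >-> R}) (g f : R -> \bar R) :
  measurable_fun [set: R] g -> (forall x, 0 <= g x)%E ->
  (forall A, measurable A ->
    distribution P W A = \int[lebesgue_measure]_(x in A) g x)%E ->
  measurable_fun [set: R] f -> (forall x, 0 <= f x)%E ->
  (\int[distribution P W]_x f x = \int[lebesgue_measure]_x (f x * g x))%E.
Proof.
move=> mg g0 WE mf f0.
have mW : measurable_fun setT (W : T -> measurableTypeR R).
  exact: (measurable_funP W).
pose W' : {mfun T >-> measurableTypeR R} :=
  HB.pack (W : T -> measurableTypeR R) (isMeasurableFun.Build _ _ _ _ _ mW).
rewrite ge0_integral_distribution//.
transitivity (\int[distribution P W']_x f x)%E.
  by rewrite ge0_integral_distribution.
exact: integral_density.
Qed.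

End random_variable_density.

(** Inversion is expressed through the measurable power function on each side of 0. The point 0
    falls in the second branch, where both expressions are 0 by the convention for the inverse of
    0. *)
Lemma measurable_invr (R : realType) : measurable_fun setT (@GRing.inv R).
Proof.
have -> : @GRing.inv R = fun x => if 0 < x then x `^ (-1) else - ((- x) `^ (-1)).
  apply/funext => x; case: ifPn => [x0|]; first by rewrite powR_inv1// ltW.
  by rewrite -leNgt => x0; rewrite powR_inv1 ?oppr_ge0// invrN opprK.
apply: measurable_fun_ifT.
- exact: measurable_fun_ltr.
- exact: measurable_powR.
- apply: measurableT_comp => //.
  by apply: (measurableT_comp (measurable_powR _)).
Qed.

(** * Gamma and exponential laws *)

Section gamma_pdf_theory.
Context {R : realType}.
Local Notation mu := (@lebesgue_measure R).
Implicit Types a c s x : R.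

Lemma gamma_fun_ge0 a : 0 <= gamma_fun a.
Proof. by apply: Rintegral_ge0 => x _; rewrite mulr_ge0 ?powR_ge0 ?expR_ge0. Qed.

Lemma gamma_pdf_ge0 a x : 0 <= gamma_pdf a x.
Proof.
rewrite /gamma_pdf patchE; case: ifPn => // _.
by rewrite divr_ge0 ?gamma_fun_ge0// mulr_ge0 ?powR_ge0 ?expR_ge0.
Qed.

Lemma measurable_gamma_pdf a : measurable_fun setT (gamma_pdf a).
Proof.
apply/measurable_restrict => //; apply: measurable_funTS.
apply: measurable_funM => //; apply: measurable_funM => //.
by apply: measurableT_comp.
Qed.

(** Rescaling the density amounts to an exponential tilt of it, which will turn the Laplace
    transform into a total mass. Off the positive half-line both sides vanish, so [x] may be
    replaced by its absolute value in the tilt. *)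
Lemma gamma_pdf_scale a c x : 0 < c ->
  gamma_pdf a (c * x) = c `^ (a - 1) * (expR (- (c - 1) * `|x|) * gamma_pdf a x).
Proof.
move=> c0; rewrite /gamma_pdf !patchE !mem_setE !in_itv/= !andbT pmulr_rgt0//.
case: ifPn => x0; last by rewrite !mulr0.
rewrite powRM ?(ltW c0) ?(ltW x0)// (gtr0_norm x0).
have -> : expR (- (c * x)) = expR (- (c - 1) * x) * expR (- x).
  by rewrite -expRD; congr expR; ring.
ring.
Qed.

Lemma gamma_cdf_ge0 a x : 0 <= gamma_cdf a x.
Proof.
by apply/fine_ge0/integral_ge0 => y _; rewrite lee_fin gamma_pdf_ge0.
Qed.

End gamma_pdf_theory.

Section gamma_law.
Context d (T : measurableType d) (R : realType) (P : probability T R).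
Variables (G : {RV P >-> R}) (a : R).
Hypothesis hG : same_law (distribution P G) (gamma_prob a).
Local Notation mu := (@lebesgue_measure R).

(** The density vanishes off the positive half-line, so the integral over it is already the total
    mass of the law of [G]. *)
Lemma gamma_law_gt0 : P (G @^-1` `]0, +oo[) = 1%E.
Proof.
transitivity (distribution P G `]0, +oo[) => //.
rewrite hG// -(probability_setT (distribution P G)) [RHS]hG//.
rewrite /gamma_prob [LHS]integral_mkcond.
apply: eq_integral => x _; rewrite patchE; case: ifPn => // x0.
by rewrite /gamma_pdf patchE (negbTE x0).
Qed.

(* The absolute value is immaterial for a law on ]0, +oo[, but it makes the
   integrand equal to P(W > s |x|) for W exponential and every real x. No
   property of the Gamma function is needed: the density has total mass 1
   because it is that of G. *)
Lemma gamma_law_laplace (s : R) : 0 <= s ->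
  (\int[distribution P G]_x (expR (- (s * `|x|)))%:E = ((1 + s) `^ (- a))%:E)%E.
Proof.
move=> s0; have c0 : 0 < 1 + s by rewrite ltr_pwDl.
have mpdf : measurable_fun setT (EFin \o gamma_pdf a).
  by apply/measurable_EFinP; exact: measurable_gamma_pdf.
have mexp : measurable_fun setT (fun x : R => (expR (- (s * `|x|)))%:E).
  apply/measurable_EFinP; apply: measurableT_comp => //.
  by apply: measurableT_comp => //; apply: measurable_funM.
have pdf_ge0 x : (0 <= (gamma_pdf a x)%:E)%E by rewrite lee_fin gamma_pdf_ge0.
have exp0 (x : R) : (0 <= (expR (- (s * `|x|)))%:E)%E by rewrite lee_fin expR_ge0.
rewrite (integral_distribution_density mpdf pdf_ge0 hG mexp exp0).
have cn0 : 1 + s != 0 by rewrite gt_eqF.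
have powc : (1 + s) `^ (1 - a) * (1 + s) `^ (a - 1) = 1.
  by rewrite -powRD ?cn0 ?implybT// (_ : 1 - a + (a - 1) = 0) ?powRr0//; ring.
(* With [c = 1 + s], the tilted density is [c^(1 - a)] times the density at [c x]. Substitution
   contributes [c^(-1)], and the product of the two factors is [c^(-a)]. *)
under eq_integral => x _.
  rewrite /= -EFinM (_ : expR _ * _ = (1 + s) `^ (1 - a) * gamma_pdf a ((1 + s) * x)); last first.
    rewrite gamma_pdf_scale// mulrA powc mul1r.
    by congr (expR _ * _); ring.
  rewrite EFinM; over.
rewrite ge0_integralZl//=; last 2 first.
- apply/measurable_EFinP.
  apply: (measurableT_comp (measurable_gamma_pdf a)).
  exact: measurable_funM.
- by rewrite lee_fin powR_ge0.
rewrite (integral_lebesgue_scale (f := EFin \o gamma_pdf a))//.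
rewrite -[X in (_ * (_ * X))%E]/(gamma_prob a setT) -hG// probability_setT mule1.
rewrite -EFinM -[X in _ * X]powR_inv1 ?(ltW c0)// -powRD ?cn0 ?implybT//.
by congr ((_ `^ _)%:E); ring.
Qed.

(** The law has a density, so the end point [c] carries no mass and strict and large inequalities
    have the same probability. *)
Lemma gamma_law_lt (c : R) : P [set t | G t < c] = (gamma_cdf a c)%:E.
Proof.
have mpdf : measurable_fun setT (EFin \o gamma_pdf a).
  by apply/measurable_EFinP; exact: measurable_gamma_pdf.
rewrite (_ : [set t | _] = G @^-1` `]-oo, c[); last first.
  by apply/seteqP; split=> t /=; rewrite in_itv.
transitivity (distribution P G `]-oo, c[) => //.
rewrite hG// /gamma_prob integral_itv_bndo_bndc; last first.
  exact: measurable_funTS.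
by rewrite -/(gamma_prob a _) /gamma_cdf fineK// -hG// fin_num_measure.
Qed.

Lemma measurable_gamma_cdf : measurable_fun setT (gamma_cdf a).
Proof.
have -> : gamma_cdf a = fine \o cdf G.
  by apply/funext => x; rewrite /= /cdf hG.
by apply: measurableT_comp; [exact: fine_measurable|exact: cdf_measurable].
Qed.

End gamma_law.

Section exponential_law.
Context d (T : measurableType d) (R : realType) (P : probability T R).
Variable W : {RV P >-> R}.
Hypothesis hW : same_law (distribution P W) (exponential_prob 1).

Lemma exponential_law_tail (c : R) : 0 <= c ->
  P [set t | c < W t] = (expR (- c))%:E.
Proof.
move=> c0.
have mc : measurable [set t | c < W t].
  rewrite (_ : [set t | _] = W @^-1` `]c, +oo[); last first.
    by apply/seteqP; split=> t /=; rewrite in_itv/= andbT.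
  exact: measurable_funPTI.
rewrite -(setCK [set t | c < W t]) probability_setC; last exact: measurableC.
rewrite (_ : ~` [set t | _] = W @^-1` `]-oo, c]); last first.
  by apply/seteqP; split=> t /=; rewrite in_itv/= leNgt => /negP.
rewrite -[X in (_ - X)%E]/(distribution P W _).
have -> : `]-oo, c]%classic = `]-oo, 0[%classic `|` `[0, c]%classic :> set R.
  apply/seteqP; split=> x /=; rewrite !in_itv/=.
    by move=> ->; rewrite andbT; case: (ltP x 0) => _; [left|right].
  by case=> [/ltW/le_trans|/andP[]//]; exact.
rewrite measureU//; last first.
  by apply/seteqP; split=> // x /=; rewrite !in_itv/= => -[+ /andP[]]; lra.
rewrite /= !hW// [X in (_ - (X + _))%E](_ : _ = 0%E); last first.
  rewrite /exponential_prob; apply: integral0_eq => x /=; rewrite in_itv/= => x0.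
  by rewrite lt0_exponential_pdf.
(* Negative values have density zero, so only the interval from 0 to [c] counts. For [c = 0] it
   degenerates to a point, of mass zero. *)
rewrite add0e; have [c0'|c0'] := ltP 0 c.
  rewrite exponential_prob_itv0c// mulN1r -[LHS]/((1 - (1 - expR (- c)))%:E).
  by congr EFin; ring.
have -> : c = 0 by lra.
by rewrite set_itv1 /exponential_prob integral_set1 sube0 oppr0 expR0.
Qed.

End exponential_law.

(** * Law of a single product [sigma W Y] *)

Lemma measurable_fun_gt d (T : measurableType d) (R : realType) (U V : T -> R) :
  measurable_fun setT U -> measurable_fun setT V ->
  measurable [set t | U t < V t].
Proof.
move=> mU mV; have := measurable_fun_ltr mU mV measurableT (I : measurable [set true]).
by rewrite setTI; congr measurable; apply/seteqP; split=> t.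
Qed.

(** The Lomax (Pareto type II) distribution function with scale [sigma] and shape [alpha]; the
    maximum gives it the value 0 on the negative half-line. *)
Definition product_cdf {R : realType} (sigma alpha r : R) :=
  1 - (1 + Num.max r 0 / sigma) `^ (- alpha).

Section exp_gamma_product.
Context d (T : measurableType d) (R : realType) (P : probability T R).
Variables (W Y X : {RV P >-> R}) (alpha sigma : R).
Hypotheses (alpha0 : 0 < alpha) (sigma0 : 0 < sigma).
Hypothesis indep : forall A B : set R, measurable A -> measurable B ->
  P (Y @^-1` A `&` W @^-1` B) = (P (Y @^-1` A) * P (W @^-1` B))%E.
Hypothesis hW : same_law (distribution P W) (exponential_prob 1).
Hypothesis hY : same_law (pushforward P (fun t => (Y t)^-1)) (gamma_prob alpha).
Hypothesis hX : forall t, X t = sigma * W t * Y t.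

Lemma measurable_inv_RV : measurable_fun setT (fun t => (Y t)^-1).
Proof. by apply: (measurableT_comp (@measurable_invr R)). Qed.

Lemma inv_gamma_gt0 : P [set t | 0 < Y t] = 1%E.
Proof.
pose G : {mfun T >-> R} :=
  HB.pack (fun t => (Y t)^-1) (isMeasurableFun.Build _ _ _ _ _ measurable_inv_RV).
rewrite -(gamma_law_gt0 (G := G) hY); congr (P _).
by apply/seteqP; split=> t /=; rewrite in_itv/= andbT invr_gt0.
Qed.

Lemma gt_product (x : R) (t : T) : 0 < Y t ->
  (x < X t) = (x / sigma * (Y t)^-1 < W t).
Proof.
by move=> Yt; rewrite hX ltr_pdivrMr// ltr_pdivrMr// (mulrC sigma) mulrAC.
Qed.

(** Conditionally on [1 / Y = y], the event has the exponential tail probability at [s |y|];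
    integrating over the law of [1 / Y] gives a gamma Laplace transform. *)
Lemma product_tail (x : R) : 0 <= x ->
  P [set t | x < X t] = ((1 + x / sigma) `^ (- alpha))%:E.
Proof.
move=> x0; have s0 : 0 <= x / sigma by rewrite divr_ge0// ltW.
set s := x / sigma in s0 *.
pose G : {mfun T >-> R} :=
  HB.pack (fun t => (Y t)^-1) (isMeasurableFun.Build _ _ _ _ _ measurable_inv_RV).
rewrite -(gamma_law_laplace (G := G) hY s0).
transitivity (P [set t | s * `|G t| < W t]).
  apply: (eq_probability_setI1 _ _ _ inv_gamma_gt0).
  - exact: measurable_fun_gt.
  - exact: measurable_fun_gt.
  - apply: measurable_fun_gt => //; apply: measurable_funM => //.
    by apply: measurableT_comp => //; exact: measurable_inv_RV.
  - by apply/seteqP; split=> t /= [Yt]; rewrite gt_product// ger0_norm ?invr_ge0 ?ltW.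
have mD : measurable [set z : R * R | s * `|z.1| < z.2].
  apply: measurable_fun_gt; last exact: measurable_snd.
  by apply: measurable_funM => //; apply: measurableT_comp.
rewrite (independent_fubini (U := G) (V := W) _ mD); last first.
  move=> A B mA mB.
  have mA' : measurable (@GRing.inv R @^-1` A).
    by rewrite -[X in measurable X]setTI; exact: measurable_invr.
  exact: (indep mA' mB).
apply: eq_integral => y _ /=; rewrite -(exponential_law_tail hW) 1?mulr_ge0//.
Qed.

Lemma product_cdfE (r : R) :
  P [set t | X t <= r] = (product_cdf sigma alpha r)%:E.
Proof.
have mle s : measurable [set t | X t <= s].
  rewrite (_ : [set t | _] = X @^-1` `]-oo, s]); first exact: measurable_funPTI.
  by apply/seteqP; split=> t /=; rewrite in_itv.
have nonneg s : 0 <= s ->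
    P [set t | X t <= s] = (product_cdf sigma alpha s)%:E.
  move=> s0; rewrite (_ : [set t | _] = ~` [set t | s < X t]); last first.
    by apply/seteqP; split=> t /=; rewrite leNgt => /negP.
  rewrite probability_setC; last exact: measurable_fun_gt.
  by rewrite product_tail// -EFinB /product_cdf max_l.
have [/nonneg//|r0] := leP 0 r.
rewrite /product_cdf max_r ?ltW// mul0r addr0 powR1 subrr.
(* For negative [r] the event lies in the one for 0, whose probability is 0 by the nonnegative
   case. *)
apply/eqP; rewrite -measure_le0 (@le_trans _ _ (P [set t | X t <= 0]))//.
  by apply: le_measure; rewrite ?inE// => t /= /le_trans; apply; exact: ltW.
by rewrite nonneg// /product_cdf max_l// mul0r addr0 powR1 subrr.
Qed.

Lemma cdf_product (r : R) : cdf X r = (product_cdf sigma alpha r)%:E.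
Proof.
rewrite -product_cdfE /cdf /distribution /pushforward; congr (P _).
Qed.

Lemma ext_cdf_product (r : R) : ext_cdf X r%:E = product_cdf sigma alpha r.
Proof. by rewrite ext_cdf_fin cdf_product. Qed.

Lemma continuous_cdf_product : continuous (cdf X).
Proof.
have -> : cdf X = EFin \o product_cdf sigma alpha.
  by apply/funext => r; rewrite cdf_product.
have pos r : 0 < 1 + Num.max r 0 / sigma.
  by rewrite ltr_pwDl// divr_ge0 ?(ltW sigma0)// le_max lexx orbT.
move=> r; apply: cvg_EFin; first by near=> x.
rewrite /product_cdf.
(* The base is positive, so the power is an exponential of a logarithm and continuity follows by
   composition. *)
have E x : (1 + Num.max x 0 / sigma) `^ (- alpha) =
    expR (- alpha * ln (1 + Num.max x 0 / sigma)).
  by rewrite /powR gt_eqF.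
under eq_fun do rewrite /= E.
rewrite /= E; apply: cvgB; first exact: cvg_cst.
apply: continuous_comp; last exact: continuous_expR.
apply: cvgM; first exact: cvg_cst.
apply: continuous_comp; last exact: continuous_ln.
apply: cvgD; first exact: cvg_cst.
apply: cvgM; last exact: cvg_cst.
by apply: continuous_max => //; exact: cvg_cst.
Unshelve. all: by end_near. Qed.

Lemma product_cdf_bounds (x : R) : 0 < x -> 0 < product_cdf sigma alpha x < 1.
Proof.
move=> x0; rewrite /product_cdf max_l ?ltW//.
have s0 : 0 < x / sigma by rewrite divr_gt0.
have p0 : 0 < (1 + x / sigma) `^ (- alpha) by rewrite powR_gt0// ltr_pwDl// ltW.
suff : (1 + x / sigma) `^ (- alpha) < 1 by lra.
rewrite powRN invf_lt1 ?powR_gt0// ?ltr_pwDl// ?ltW//.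
have E1 : (1 : R) `^ alpha = 1 by rewrite powR1.
by rewrite -[ltLHS]E1 gt0_ltr_powR// ?nnegrE//; lra.
Qed.

(** The exponents [- alpha] and [- 1 / alpha] have product 1. This identifies the denominators in
    the copula formula when its arguments are values of the margins. *)
Lemma product_cdf_inv (x : R) : 0 < x ->
  (1 - product_cdf sigma alpha x) `^ (- 1 / alpha) - 1 = x / sigma.
Proof.
move=> x0; rewrite /product_cdf max_l ?ltW// subKr -powRrM.
rewrite (_ : - alpha * (- 1 / alpha) = 1); last by field; rewrite gt_eqF.
by rewrite powRr1 ?addrK 1?addrC ?addKr//; rewrite addr_ge0// divr_ge0// ltW.
Qed.

Lemma ext_cdf_product_onto (u : R) : 0 <= u <= 1 -> exists x, ext_cdf X x = u.
Proof.
case/andP; rewrite le_eqVlt => /predU1P[<- _|u0].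
  by exists -oo%E; rewrite ext_cdfNy.
rewrite le_eqVlt => /predU1P[->|u1]; first by exists +oo%E; rewrite ext_cdfy.
(* For an interior level the witness is the quantile [sigma (q - 1)], the solution of
   [1 + x / sigma = q]. Since [q >= 1] it is nonnegative, so the maximum in [product_cdf] is
   harmless. *)
have v0 : 0 < 1 - u by lra.
set q := (1 - u) `^ (- alpha^-1).
have q1 : 1 <= q.
  rewrite -(powRr0 (1 - u)) ger_powR//; first by lra.
  by rewrite oppr_le0 invr_ge0 ltW.
exists (sigma * (q - 1))%:E; rewrite ext_cdf_product /product_cdf max_l; last first.
  by rewrite mulr_ge0 ?subr_ge0// ltW.
rewrite (_ : 1 + sigma * (q - 1) / sigma = q); last by field; rewrite gt_eqF.
rewrite -powRrM mulrNN mulVf ?gt_eqF// powRr1 ?ltW//; lra.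
Qed.

End exp_gamma_product.

(** * Joint law of the two products *)

Section joint_law.
Context d (T : measurableType d) (R : realType) (P : probability T R).
Variables (alpha1 alpha2 sigma1 sigma2 : R).
Hypotheses (halpha1 : 0 < alpha1) (halpha2 : 0 < alpha2).
Hypotheses (hsigma1 : 0 < sigma1) (hsigma2 : 0 < sigma2).
Variables (W Y1 Y2 X1 X2 : {RV P >-> R}).
Hypothesis hindep : independent3 P W Y1 Y2.
Hypothesis hW : same_law (distribution P W) (exponential_prob 1).
Hypothesis hY1 : same_law (pushforward P (fun t => (Y1 t)^-1)) (gamma_prob alpha1).
Hypothesis hY2 : same_law (pushforward P (fun t => (Y2 t)^-1)) (gamma_prob alpha2).
Hypothesis hX1 : forall t : T, X1 t = sigma1 * W t * Y1 t.
Hypothesis hX2 : forall t : T, X2 t = sigma2 * W t * Y2 t.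

Let indep1 := (independent3_sym hindep).1.
Let indep2 := (independent3_sym hindep).2.

Let G1 : {mfun T >-> R} :=
  HB.pack (fun t => (Y1 t)^-1) (isMeasurableFun.Build _ _ _ _ _ (measurable_inv_RV Y1)).
Let G2 : {mfun T >-> R} :=
  HB.pack (fun t => (Y2 t)^-1) (isMeasurableFun.Build _ _ _ _ _ (measurable_inv_RV Y2)).

Lemma joint_tail (x1 x2 : R) : 0 < x1 -> 0 < x2 ->
  (P ([set t | (x1 < X1 t)%R] `&` [set t | (x2 < X2 t)%R]) =
   \int[lebesgue_measure]_(w in `]0%R, +oo[)
     (gamma_cdf alpha1 (w / (x1 / sigma1)) *
      gamma_cdf alpha2 (w / (x2 / sigma2)) * expR (- w))%:E)%E.
Proof.
move=> x10 x20.
have s10 : 0 < x1 / sigma1 by rewrite divr_gt0.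
have s20 : 0 < x2 / sigma2 by rewrite divr_gt0.
set s1 := x1 / sigma1 in s10 *; set s2 := x2 / sigma2 in s20 *.
have mgt (c : R) (X : {RV P >-> R}) : measurable [set t | c < X t] by exact: measurable_fun_gt.
have mgtG (c : R) (Y : {RV P >-> R}) : measurable [set t | c * (Y t)^-1 < W t].
  apply: measurable_fun_gt => //; apply: measurable_funM => //.
  exact: measurable_inv_RV.
(* Almost surely [Y1] and [Y2] are positive, and the joint tail event then says that [(W, (Y1, Y2))]
   lies in [D]. As [W] is independent of the pair, the probability is an integral over the law of
   [W]. *)
pose D := [set z : R * (R * R) | s1 * z.2.1^-1 < z.1] `&`
          [set z : R * (R * R) | s2 * z.2.2^-1 < z.1].
transitivity (P [set t | D (W t, (Y1 t, Y2 t))]).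
  apply: (@eq_probability_setI1 _ _ _ _ ([set t | 0 < Y1 t] `&` [set t | 0 < Y2 t])).
  - by apply: measurableI; exact: mgt.
  - by apply: measurableI; exact: mgt.
  - exact: (measurableI _ _ (mgtG s1 Y1) (mgtG s2 Y2)).
  - by rewrite probability1_setI ?(inv_gamma_gt0 hY1) ?(inv_gamma_gt0 hY2)//; exact: mgt.
  - apply/seteqP; split=> t /= [[Y1t Y2t]].
      by rewrite (gt_product hsigma1 hX1)// (gt_product hsigma2 hX2).
    by rewrite (gt_product hsigma1 hX1)// (gt_product hsigma2 hX2).
have mV : measurable_fun setT (fun t => (Y1 t, Y2 t)) by exact: measurable_fun_pair.
pose V : {mfun T >-> (R * R)%type} :=
  HB.pack (fun t => (Y1 t, Y2 t)) (isMeasurableFun.Build _ _ _ _ _ mV).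
have mD : measurable D.
  apply: measurableI; apply: measurable_fun_gt; try exact: measurable_fst.
  - apply: measurable_funM => //; apply: (measurableT_comp (@measurable_invr R)).
    by apply: measurableT_comp; [exact: measurable_fst|exact: measurable_snd].
  - apply: measurable_funM => //; apply: (measurableT_comp (@measurable_invr R)).
    by apply: measurableT_comp; [exact: measurable_snd|exact: measurable_snd].
rewrite (independent_fubini (U := W) (V := V) _ mD); last first.
  by move=> A B mA mB; exact: independent3_pair.
have mF1 := measurable_gamma_cdf (G := G1) hY1.
have mF2 := measurable_gamma_cdf (G := G2) hY2.
have mF : measurable_fun [set: R]
    (fun w => gamma_cdf alpha1 (w / s1) * gamma_cdf alpha2 (w / s2)).
  apply: measurable_funM.
    by apply: (measurableT_comp mF1); exact: measurable_funM.
  by apply: (measurableT_comp mF2); exact: measurable_funM.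
transitivity (\int[distribution P W]_w
    (gamma_cdf alpha1 (w / s1) * gamma_cdf alpha2 (w / s2))%:E)%E.
  apply: eq_integral => w _.
  (* For fixed [w], the section of [D] is the rectangle [E s1] times [E s2], so independence of [Y1]
     and [Y2] yields the product of two gamma distribution functions. *)
  pose E (s : R) := [set y : R | s * y^-1 < w].
  have mE (s : R) : measurable (E s).
    apply: measurable_fun_gt => //; apply: measurable_funM => //.
    exact: measurable_invr.
  have := hindep measurableT (mE s1) (mE s2).
  rewrite preimage_setT setTI probability_setT mul1e => H.
  transitivity (P (Y1 @^-1` E s1) * P (Y2 @^-1` E s2))%E.
    by rewrite -H; congr (P _).
  have F1 : P [set t | G1 t < w / s1] = (gamma_cdf alpha1 (w / s1))%:E.
    exact: (gamma_law_lt (G := G1) hY1).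
  have F2 : P [set t | G2 t < w / s2] = (gamma_cdf alpha2 (w / s2))%:E.
    exact: (gamma_law_lt (G := G2) hY2).
  rewrite EFinM; congr (_ * _)%E; [apply: (etrans _ F1)|apply: (etrans _ F2)].
  - by congr (P _); apply/seteqP; split=> t /=; rewrite ltr_pdivlMr// mulrC.
  - by congr (P _); apply/seteqP; split=> t /=; rewrite ltr_pdivlMr// mulrC.
have mpdf : measurable_fun [set: R] (EFin \o exponential_pdf 1).
  by apply/measurable_EFinP; exact: measurable_exponential_pdf.
have pdf0 (w : R) : (0 <= (exponential_pdf 1 w)%:E)%E.
  by rewrite lee_fin exponential_pdf_ge0.
rewrite (integral_distribution_density mpdf pdf0 hW); last 2 first.
- exact/measurable_EFinP.
- by move=> w; rewrite lee_fin mulr_ge0 ?gamma_cdf_ge0.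
(* The exponential density is supported on the closed half-line while the copula formula integrates
   over the open one; the point 0 is null. *)
rewrite [RHS]integral_itv_obnd_cbnd; last first.
  apply: measurable_funTS; apply/measurable_EFinP; apply: measurable_funM => //.
  exact: measurableT_comp.
rewrite [RHS]integral_mkcond; apply: eq_integral => w _ /=.
rewrite /exponential_pdf !patchE; case: ifPn => _; last by rewrite mule0.
by rewrite -EFinM mul1r mulN1r.
Qed.

Lemma joint_sklar : sklar_identity X1 X2 (exp_gamma_copula alpha1 alpha2).
Proof.
have F1 := ext_cdf_product hsigma1 indep1 hW hY1 hX1.
have F2 := ext_cdf_product hsigma2 indep2 hW hY2 hX2.
have F1_0 r : r <= 0 -> ext_cdf X1 r%:E = 0.
  by move=> r0; rewrite F1 /product_cdf max_r// mul0r addr0 powR1 subrr.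
have F2_0 r : r <= 0 -> ext_cdf X2 r%:E = 0.
  by move=> r0; rewrite F2 /product_cdf max_r// mul0r addr0 powR1 subrr.
(* On the sides of the square, the definition by cases takes the values forced by groundedness and
   uniform margins. These settle every pair of arguments for which a margin has level 0 or 1:
   infinite or nonpositive ones. *)
have C0r (u : R) : 0 <= u <= 1 -> exp_gamma_copula alpha1 alpha2 0 u = 0.
  move=> /andP[u0 u1]; rewrite /exp_gamma_copula ltxx lexx ler01/= (eq_sym 0 1) oner_eq0.
  by case: ifP.
have Cr0 (u : R) : 0 <= u <= 1 -> exp_gamma_copula alpha1 alpha2 u 0 = 0.
  move=> /andP[u0 u1]; rewrite /exp_gamma_copula ltxx andbF (eq_sym 0 1) oner_eq0 andbF.
  by case: ifP.
have C1r (u : R) : 0 <= u <= 1 -> exp_gamma_copula alpha1 alpha2 1 u = u.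
  move=> /andP[u0 u1]; rewrite /exp_gamma_copula ltxx andbF/= lexx ler01/= eqxx u0/=.
  by case: eqVneq => // un1; rewrite lt_neqAle un1 u1.
have Cr1 (u : R) : 0 <= u <= 1 -> exp_gamma_copula alpha1 alpha2 u 1 = u.
  by move=> u01; rewrite /exp_gamma_copula ltxx !andbF u01 eqxx.
have zero1 x1 x2 : ext_cdf X1 x1 = 0 ->
    ext_joint_cdf X1 X2 x1 x2 =
    exp_gamma_copula alpha1 alpha2 (ext_cdf X1 x1) (ext_cdf X2 x2).
  by move=> Fx; rewrite ext_joint_cdf_eq0// Fx C0r// ext_cdf_range.
have zero2 x1 x2 : ext_cdf X2 x2 = 0 ->
    ext_joint_cdf X1 X2 x1 x2 =
    exp_gamma_copula alpha1 alpha2 (ext_cdf X1 x1) (ext_cdf X2 x2).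
  by move=> Fx; rewrite ext_joint_cdfC ext_joint_cdf_eq0// Fx Cr0// ext_cdf_range.
case=> [x1| |] x2; last 2 first.
- by rewrite ext_joint_cdf_eq1 ?ext_cdfy// C1r// ext_cdf_range.
- by rewrite zero1// ext_cdfNy.
case: x2 => [x2| |]; last 2 first.
- by rewrite ext_joint_cdf_yr ext_cdfy Cr1// ext_cdf_range.
- by rewrite zero2// ext_cdfNy.
have [/F1_0|x10] := leP x1 0; first exact: zero1.
have [/F2_0|x20] := leP x2 0; first exact: zero2.
have mgt (c : R) (X : {RV P >-> R}) : measurable [set t | c < X t] by exact: measurable_fun_gt.
have tailE (X : {RV P >-> R}) c :
    fine (P [set t | c < X t]) = 1 - ext_cdf X c%:E.
  rewrite /ext_cdf (_ : [set t | ((X t)%:E <= c%:E)%E] = ~` [set t | c < X t]); last first.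
    by apply/seteqP; split=> t /=; rewrite lee_fin leNgt => /negP.
  rewrite probability_setC// fineB ?fin_num_measure//= ; lra.
set u1 := ext_cdf X1 x1%:E; set u2 := ext_cdf X2 x2%:E.
have u1_01 : 0 < u1 < 1 by rewrite /u1 F1 product_cdf_bounds.
have u2_01 : 0 < u2 < 1 by rewrite /u2 F2 product_cdf_bounds.
rewrite /exp_gamma_copula u1_01 u2_01/=.
(* Both levels are interior. The denominators become [x1 / sigma1] and [x2 / sigma2], so the
   integral is the joint tail probability. *)
rewrite {2}/u1 {2}/u2 F1 F2 !product_cdf_inv// /Rintegral -joint_tail//.
set A := [set t | x1 < X1 t]; set B := [set t | x2 < X2 t].
have mA : measurable A by exact: mgt.
have mB : measurable B by exact: mgt.
have mA' : measurable (~` A) by exact: measurableC.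
(* Inclusion-exclusion in two steps: [P(~A & ~B) = P(~A) - P(~A & B)] and
   [P(B & ~A) = P(B) - P(B & A)]. With [P(~A) = u1] and [P(B) = 1 - u2] this is
   [u1 + u2 - 1 + P(A & B)]. *)
have EB := fine_probability_setI_diff P mA' mB measurableT (@subsetT _ B).
have EA := fine_probability_setI_diff P mB mA measurableT (@subsetT _ A).
rewrite !setIT !setTD in EA EB.
have -> : ext_joint_cdf X1 X2 x1%:E x2%:E = fine (P (~` A `&` ~` B)).
  rewrite /ext_joint_cdf; congr (fine (P _)).
  by apply/seteqP; split=> t /=; rewrite !lee_fin !leNgt => -[/negP ? /negP ?].
have PA : fine (P (~` A)) = u1.
  by rewrite probability_setC// fineB ?fin_num_measure//= tailE -/u1; lra.
have PB : fine (P B) = 1 - u2 by rewrite tailE.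
rewrite -EB (setIC (~` A)) -EA PA PB (setIC B); lra.
Qed.

End joint_law.

Theorem theorem3p1 (d : measure_display) (T : measurableType d) (R : realType)
    (P : probability T R) (alpha1 alpha2 sigma1 sigma2 : R)
    (halpha1 : 0 < alpha1) (halpha2 : 0 < alpha2)
    (hsigma1 : 0 < sigma1) (hsigma2 : 0 < sigma2)
    (W Y1 Y2 X1 X2 : {RV P >-> R})
    (hindep : independent3 P W Y1 Y2)
    (hW : same_law (distribution P W) (exponential_prob 1))
    (hY1 : same_law (pushforward P (fun t => (Y1 t)^-1)) (gamma_prob alpha1))
    (hY2 : same_law (pushforward P (fun t => (Y2 t)^-1)) (gamma_prob alpha2))
    (hX1 : forall t : T, X1 t = sigma1 * W t * Y1 t)
    (hX2 : forall t : T, X2 t = sigma2 * W t * Y2 t) :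
  (forall u1 u2 : R, 0 <= u1 <= 1 -> 0 <= u2 <= 1 ->
     0 <= exp_gamma_copula alpha1 alpha2 u1 u2 <= 1) /\
  is_copula_of X1 X2 (exp_gamma_copula alpha1 alpha2).
Proof.
have [indep1 indep2] := independent3_sym hindep.
have onto1 := ext_cdf_product_onto halpha1 hsigma1 indep1 hW hY1 hX1.
have onto2 := ext_cdf_product_onto halpha2 hsigma2 indep2 hW hY2 hX2.
have sklar := joint_sklar halpha1 halpha2 hsigma1 hsigma2 hindep hW hY1 hY2 hX1 hX2.
split; first exact: (sklar_copula_range onto1 onto2 sklar).
split.
- exact: (continuous_cdf_product hsigma1 indep1 hW hY1 hX1).
- exact: (continuous_cdf_product hsigma2 indep2 hW hY2 hX2).
- exact: (sklar_is_copula onto1 onto2 sklar).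
- exact: sklar.
- by move=> C' _; exact: (sklar_copula_unique onto1 onto2 sklar).
Qed.
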